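(* Let $\Delta$ be a centred, surjective, essential toric arrangement in a complex torus $T$ with poset of layers $\mathscr{S}$. For any other essential toric arrangement $\Delta'$ in $T$ with the same poset of layers $\mathscr{S}$, there exists an automorphism $g$ of the torus $T$ that sends the open set $M(\Delta')$ homeomorphically into $M(\Delta)$.
   Context: A toric arrangement in a torus $T\simeq(\mathbb{C}^* )^r$ with character group $\Lambda$ is a finite family $\Delta=\{(a_e,\chi_e)\}_{e\in E}$, $a_e\in\mathbb{C}^*$, $\chi_e\in\Lambda$, with hypertori $H_e=\{t\in T:a_e\chi_e(t)=1\}$ and complement $M(\Delta)=T\setminus\bigcup_{e\in E}H_e$. It is centred if $a_e=1$ for all $e$, surjective if the characters $\chi_e$ generate $\Lambda$, and essential if the sublattice they generate has maximal rank $r$ in $\Lambda$. The poset of layers $\mathscr{S}$ is the set of connected components of intersections of hypertori, ordered by reverse inclusion.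
   Formalization: ''Same poset of layers'' means a poset isomorphism matching the families of components of hypertori; a bare one fails for {t=1, t³=1} versus {t=1, t=2, t=3}. ''Automorphism of the torus'' is as a variety (translations allowed), needed since Δ' may be non-centred. *)

(* Defs.v *)
From HB Require Import structures.
From mathcomp Require Import all_boot all_order all_algebra.
From mathcomp Require Import complex.
From mathcomp Require Import all_classical all_reals all_analysis.

Set Implicit Arguments.
Unset Strict Implicit.
Unset Printing Implicit Defensive.

Import Order.TTheory GRing.Theory Num.Theory.
Import numFieldNormedType.Exports.

Local Open Scope classical_set_scope.
Local Open Scope ring_scope.

(* The type annotation is what gives C the topology of its norm: the library
   attaches that topology to the carrier of an abstract numClosedFieldType,
   not to the type constructor [complex]. *)
Definition C (R : realType) : numClosedFieldType := R[i].

Section ToricArrangements.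
Variables (R : realType) (r : nat).

(* T is the r-th power of the multiplicative group of C, as a subset of C^r. *)
Definition torus : set 'rV[C R]_r := [set t | forall i, t 0 i != 0].

(* The character lattice is Z^r: the row vector m stands for the character
   t |-> t_1^m_1 ... t_r^m_r. *)
Definition character (m : 'rV[int]_r) (t : 'rV[C R]_r) : C R :=
  \prod_(i < r) t 0 i ^ m 0 i.

Record toric_arrangement (E : finType) := ToricArrangement {
  coef : E -> C R;
  chr : E -> 'rV[int]_r;
  coef_neq0 : forall e, coef e != 0
}.

Section Arrangement.
Variables (E : finType) (D : toric_arrangement E).

Definition hypertorus (e : E) : set 'rV[C R]_r :=
  [set t | torus t /\ coef D e * character (chr D e) t = 1].

Definition arr_complement : set 'rV[C R]_r :=
  torus `\` \bigcup_e hypertorus e.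

Definition centred : Prop := forall e, coef D e = 1.

Definition surjective_arr : Prop :=
  forall m : 'rV[int]_r, exists c : E -> int, m = \sum_(e : E) chr D e *~ c e.

Definition essential : Prop :=
  \rank (\matrix_(k < #|E|, j < r) (chr D (enum_val k) 0 j)%:~R : 'M[rat]_(#|E|, r))
  = r.

(* The empty intersection is the torus itself. *)
Definition flat (S : set E) : set 'rV[C R]_r :=
  torus `&` \bigcap_(e in S) hypertorus e.

Definition components (A : set 'rV[C R]_r) : set (set 'rV[C R]_r) :=
  [set L | exists2 x, A x & L = connected_component A x].

Definition layers : set (set 'rV[C R]_r) :=
  [set L | exists S : set E, components (flat S) L].

End Arrangement.

Definition layer_le (X Y : set 'rV[C R]_r) : Prop := Y `<=` X.

(* An isomorphism of the posets of layers which remembers which layers make up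
   a hypertorus.  The last clause is automatic when all characters are
   primitive, as the hypertori are then exactly the atoms.  In general it cannot
   be dropped: for r = 1, the arrangements {t = 1, t^3 = 1} and
   {t = 1, t = 2, t = 3} both have a poset of layers with one minimum and three
   atoms, but no automorphism of T carries {1, 2, 3} to the cube roots of
   unity. *)
Definition same_layer_poset (E E' : finType)
    (D : toric_arrangement E) (D' : toric_arrangement E') : Prop :=
  exists phi : set 'rV[C R]_r -> set 'rV[C R]_r,
    [/\ set_bij (layers D) (layers D') phi,
        forall X Y, layers D X -> layers D Y ->
          (layer_le (phi X) (phi Y) <-> layer_le X Y) &
        [set phi @` components (hypertorus D e) | e in [set: E]] =
        [set components (hypertorus D' e') | e' in [set: E']]].

(* The coordinate ring of T is the group algebra of the character lattice, so
   a regular function is a finite linear combination of characters. *)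
Definition regular_function (f : 'rV[C R]_r -> C R) : Prop :=
  exists s : seq (C R * 'rV[int]_r),
    forall t, torus t -> f t = \sum_(p <- s) p.1 * character p.2 t.

Definition torus_morphism (g : 'rV[C R]_r -> 'rV[C R]_r) : Prop :=
  set_fun torus torus g /\ forall j, regular_function (fun t => g t 0 j).

(* Automorphisms of T as an algebraic variety; translations are included, as
   they must be since the second arrangement need not be centred. *)
Definition torus_automorphism (g : 'rV[C R]_r -> 'rV[C R]_r) : Prop :=
  torus_morphism g /\
  exists h, [/\ torus_morphism h, {in torus, cancel g h} & {in torus, cancel h g}].

(* g restricts to a homeomorphism from A onto B. *)
Definition homeomorphic_onto (A B : set 'rV[C R]_r)
    (g : 'rV[C R]_r -> 'rV[C R]_r) : Prop :=
  [/\ set_bij A B g, {within A, continuous g} &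
      exists h, [/\ {in A, cancel g h} & {within B, continuous h}]].

End ToricArrangements.

(* Main.v *)
Require Import Defs.
From mathcomp Require Import all_boot all_order all_algebra.
From mathcomp Require Import ring separable cyclotomic complex.
From mathcomp Require Import all_classical all_reals all_analysis.

(* The intersection of the hypertori indexed by an r-tuple f has |det f| points
   if the determinant of the characters is nonzero, and otherwise has no
   isolated point.  As the point layer {1} of D is matched with a point layer
   {x'} of D', which lies on every hypertorus of D', the poset determines all
   |det f|.  Two vector families with the same |r x r minors| differ by a linear
   map and signs; this map is integral because the characters of D generate the
   lattice, and it is unimodular.  Composed with the translation by x', it is
   the required automorphism.

   For the uniqueness up to signs, one matches the vectors one at a time.  If v
   is to be matched with v', then v - v' and v + v' have disjoint supports in
   every basis of earlier vectors; hence they lie in complementary unions of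
   connected components of the matroid of the earlier vectors, and changing the
   sign on one of these unions makes v match v'. *)

Set Implicit Arguments.
Unset Strict Implicit.
Unset Printing Implicit Defensive.

Import Order.TTheory GRing.Theory Num.Theory.
Import numFieldNormedType.Exports.

Local Open Scope classical_set_scope.
Local Open Scope ring_scope.

(** * Vector families whose maximal minors agree up to sign *)

Definition replace (I : eqType) (T : Type) (g : I -> T) (i : I) (x : T) : I -> T :=
  fun j => if j == i then x else g j.

Definition rows_mx (R : Type) (r : nat) (E : Type) (X : E -> 'rV[R]_r)
    (g : 'I_r -> E) : 'M[R]_r :=
  \matrix_(i, j) X (g i) 0 j.

Section Signs.
Variables (F : numFieldType) (r : nat) (E : finType).
Implicit Types (X : E -> 'rV[F]_r) (g : 'I_r -> E) (C : 'M[F]_r) (K : {pred E}).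

Lemma row_rows_mx X g i : row i (rows_mx X g) = X (g i).
Proof. by apply/rowP => j; rewrite !mxE. Qed.

Lemma rows_mxM X g C : rows_mx (fun e => X e *m C) g = rows_mx X g *m C.
Proof. by apply/row_matrixP => i; rewrite row_mul !row_rows_mx. Qed.

(** Cramer's rule: [X e *m C] holds the coordinates of [X e] in the basis [X \o g], and expanding
    along the replaced row produces the entry of the adjugate. *)
Lemma coord_replace X g C i e : C *m rows_mx X g = 1%:M ->
  \det (rows_mx X (replace g i e)) = (X e *m C) 0 i * \det (rows_mx X g).
Proof.
set B := rows_mx X g => CB.
have [_ Bu] := mulmx1_unit CB.
have -> : C = invmx B by rewrite -[C]mulmx1 -(mulmxV Bu) mulmxA CB mul1mx.
rewrite /invmx Bu -scalemxAr mxE.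
rewrite unitmxE in Bu.
rewrite mulrAC mulVr // mul1r (expand_det_row _ i) mxE.
apply: eq_bigr => j _; rewrite !mxE /replace eqxx; congr (_ * _).
rewrite /cofactor; congr (_ * \det _); apply/matrixP => a b; rewrite !mxE.
by rewrite eq_sym (negbTE (neq_lift _ _)).
Qed.

Section Pivot.
Variables (y : 'rV[F]_r) (i0 : 'I_r).
Hypothesis yi0 : y 0 i0 != 0.

(** Inverse of the identity matrix with row [i0] replaced by [y]. Right multiplication by it
    converts coordinates when the basis vector [i0] is exchanged for the vector with coordinates
    [y]. *)
Definition pivot_mx : 'M[F]_r :=
  \matrix_(i, j) if i == i0 then (if j == i0 then (y 0 i0)^-1 else - y 0 j / y 0 i0)
                 else (i == j)%:R.

Lemma pivotE (c : 'rV[F]_r) j : j != i0 ->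
  (c *m pivot_mx) 0 j = c 0 j - c 0 i0 * (y 0 j / y 0 i0).
Proof.
move=> ji; rewrite mxE (bigD1 i0) //= (bigD1 j) //= !mxE !eqxx (negbTE ji).
rewrite big1 ?addr0; first by rewrite mulr1; ring.
move=> k /andP[ki kj]; rewrite !mxE (negbTE ki) (negbTE kj) mulr0 //.
Qed.

Lemma pivot_mxP :
  pivot_mx *m
  (\matrix_(i, j) replace (fun i => (1%:M : 'M[F]_r) i j) i0 (y 0 j) i) = 1%:M.
Proof.
apply/row_matrixP => i; rewrite row_mul; set c := row i pivot_mx.
apply/rowP => j; rewrite mxE (bigD1 i0) //= !mxE /replace eqxx.
have -> : \sum_(k < r | k != i0)
      c 0 k * (\matrix_(a, b) (if a == i0 then y 0 b else (1%:M : 'M[F]_r) a b)) k j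
    = (j != i0)%:R * c 0 j.
  case: (eqVneq j i0) => [->|ji] /=.
    rewrite mul0r big1 // => k ki; by rewrite !mxE (negbTE ki) mulr0.
  rewrite (bigD1 j) //= big1 ?addr0 => [|k /andP[ki kj]]; rewrite !mxE.
    by rewrite (negbTE ji) eqxx mulr1 mul1r.
  by rewrite (negbTE ki) (negbTE kj) mulr0.
rewrite !mxE ?eqxx; case: (eqVneq i i0) => [->|ii].
  case: (eqVneq j i0) => [->|ji] /=; first by rewrite ?eqxx ?mul0r ?addr0 mulVf.
  by rewrite ?(negbTE ji) mul1r; field.
case: (eqVneq j i0) => [->|ji] /=; rewrite ?(negbTE ii) ?mul0r ?mul1r ?add0r ?addr0 //.
Qed.
End Pivot.

Lemma pivot_basis X g C i0 k : C *m rows_mx X g = 1%:M ->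
  (X k *m C) 0 i0 != 0 ->
  (C *m pivot_mx (X k *m C) i0) *m rows_mx X (replace g i0 k) = 1%:M.
Proof.
move=> CB y0.
have -> : rows_mx X (replace g i0 k) =
  (\matrix_(i, j) replace (fun i => (1%:M : 'M[F]_r) i j) i0 ((X k *m C) 0 j) i) *m rows_mx X g.
  apply/row_matrixP => i; rewrite row_mul row_rows_mx.
  rewrite /replace; case: ifP => [ii|ii].
    rewrite -[LHS]mulmx1 -CB mulmxA; congr (_ *m _).
    by apply/rowP => j; rewrite [RHS]mxE [RHS]mxE ii.
  rewrite -row_rows_mx -{1}[rows_mx X g]mul1mx row_mul; congr (_ *m _).
  by apply/rowP => j; rewrite !mxE ii.
by rewrite -mulmxA [X in _ *m X]mulmxA pivot_mxP // mul1mx.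
Qed.

(** [C] is kept as data because [z *m C] is then the coordinate vector of [z] in the basis
    [X \o g]. *)
Definition dual_basis X K g C := (forall i, g i \in K) /\ C *m rows_mx X g = 1%:M.

(** Distinct basis vectors are adjacent when they lie on a common fundamental circuit, so the
    components of this graph are the traces on the basis of the connected components of the matroid
    of [K]. *)
Definition fundamental_edge X K C : rel 'I_r := fun i j =>
  [exists k in K, ((X k *m C) 0 i != 0) && ((X k *m C) 0 j != 0)].

Section Separation.
Variables (X : E -> 'rV[F]_r) (K : {pred E}) (u w : 'rV[F]_r).
Hypothesis uw : forall g C, dual_basis X K g C ->
  forall i, (u *m C) 0 i = 0 \/ (w *m C) 0 i = 0.

(* A pivot along the first edge of the walk moves the support of [u] to its
   second vertex; the rest of the walk survives unless it had a shortcut. *)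
Lemma no_walk n g C i p : dual_basis X K g C -> (size p <= n)%N ->
  path (fundamental_edge X K C) i p ->
  (u *m C) 0 i != 0 -> (w *m C) 0 (last i p) = 0.
Proof.
elim: n g C i p => [|n IH] g C i [|i1 p] // gC; rewrite ?ltnS //=.
- by move=> _ _ ui; case: (uw gC i) => // u0; rewrite u0 eqxx in ui.
- by move=> _ _ ui; case: (uw gC i) => // u0; rewrite u0 eqxx in ui.
move=> sp /andP[e1 pp] ui.
have [u1|u1] := eqVneq ((u *m C) 0 i1) 0; last exact: (IH g C i1 p).
have [hp|hp] := boolP (has (fundamental_edge X K C i) p).
  case/hasP: hp => x xp ex; case/splitPr: xp sp pp => p1 p2 sp.
  rewrite cat_path last_cat /= => /and3P[_ _ pp2].
  apply: (IH g C i (x :: p2)) => //=; last by rewrite ex.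
  have {}sp : (size (p1 ++ x :: p2) <= n)%N := sp.
  by apply: leq_trans sp; rewrite size_cat leq_addl.
case/existsP: e1 => k /andP[kK /andP[y0 y1]].
have i1i : i1 != i by apply: contraNneq ui => <-; rewrite u1.
set C' := C *m pivot_mx (X k *m C) i.
have gC' : dual_basis X K (replace g i k) C'.
  case: gC => gK CB; split; first by move=> j; rewrite /replace; case: ifP.
  exact: pivot_basis.
have w0 : (w *m C) 0 i = 0.
  by case: (uw gC i) => // u0; rewrite u0 eqxx in ui.
have wE j : j != i -> (w *m C') 0 j = (w *m C) 0 j.
  by move=> ji; rewrite /C' mulmxA pivotE // w0 mul0r subr0.
(* No vertex of [p] is adjacent to [i], so the vectors giving the remaining edges have zero [i]-th
   coordinate, and the pivot leaves their other coordinates unchanged. *)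
have pp' : path (fundamental_edge X K C') i1 p.
  elim: p i1 hp pp {sp u1 y1 i1i} => //= b p IHp a /norP[nb np] /andP[eab pb].
  rewrite IHp // andbT.
  case/existsP: eab => m /andP[mK /andP[ya yb]].
  have m0 : (X m *m C) 0 i = 0.
    apply/eqP/negPn/negP => mi; move/negP: nb; apply.
    by apply/existsP; exists m; rewrite mK mi yb.
  have nei j : (X m *m C) 0 j != 0 -> j != i by apply: contraNneq => ->; rewrite m0.
  apply/existsP; exists m; rewrite mK /= /C' mulmxA.
  by rewrite !pivotE ?nei // m0 !mul0r !subr0 ya yb.
(* The walk does not end at [i], since the loop at [i] given by [k] would then be a shortcut. *)
have <- : (w *m C') 0 (last i1 p) = (w *m C) 0 (last i1 p).
  apply: wE; case: (lastP p) hp pp => [//|q z] hp pp.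
  rewrite last_rcons; apply: contraNneq hp => zi.
  rewrite has_rcons zi; apply/orP; left; apply/existsP; exists k.
  by rewrite kK y0.
apply: (IH (replace g i k) C' i1 p gC') => //.
rewrite /C' mulmxA pivotE // u1 sub0r oppr_eq0 mulf_neq0 // mulf_neq0 // invr_eq0 //.
Qed.

(** [s] negates the basis vectors in the graph components that meet the support of [w] and fixes the
    others. By [no_walk] the support of [u] avoids these components, and the support of each [X k]
    lies in a single component, which makes [X k] an eigenvector. *)
Lemma separating_involution g C : dual_basis X K g C ->
  exists2 s : 'M[F]_r, [/\ s *m s = 1%:M, u *m s = u & w *m s = - w] &
    forall k, k \in K -> exists b : bool, X k *m s = (-1) ^+ b *: X k.
Proof.
move=> gC; have [gK CB] := gC.
pose e := fundamental_edge X K C.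
have esym : symmetric e.
  by move=> i j; apply: eq_existsb => k; congr (_ && _); exact: andbC.
have cs : connect_sym e by apply: sym_connect_sym.
pose J := [pred i | [exists j, ((w *m C) 0 j != 0) && connect e i j]].
pose d : 'rV[F]_r := \row_i (-1) ^+ (J i).
pose s := C *m diag_mx d *m rows_mx X g.
have [_ Bu] := mulmx1_unit CB.
have BC : rows_mx X g *m C = 1%:M by exact: mulmx1C.
have Ds (z : 'rV[F]_r) : z *m s = (\row_i ((-1) ^+ (J i) * (z *m C) 0 i)) *m rows_mx X g.
  rewrite /s !mulmxA; congr (_ *m _); apply/rowP => i.
  by rewrite mul_mx_diag !mxE mulrC.
have zE (z : 'rV[F]_r) : z *m C *m rows_mx X g = z by rewrite -mulmxA CB mulmx1.
exists s; first split.
- rewrite /s !mulmxA -[C *m _ *m _ *m C]mulmxA BC mulmx1 -[C *m _ *m _]mulmxA.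
  have -> : diag_mx d *m diag_mx d = 1%:M.
    rewrite mulmx_diag; apply/matrixP => i j; rewrite !mxE -expr2.
    by rewrite sqrr_sign.
  by rewrite mulmx1.
- rewrite Ds -{2}[u]zE; congr (_ *m _); apply/rowP => i; rewrite mxE.
  case: (boolP (J i)) => Ji; last by rewrite expr0 mul1r.
  case/existsP: Ji => j /andP[wj /connectP[p pp jE]].
  have [->|ui] := eqVneq ((u *m C) 0 i) 0; first by rewrite mulr0.
  by move: wj; rewrite jE (no_walk gC (leqnn _) pp ui) eqxx.
- rewrite Ds -{2}[w]zE -mulNmx; congr (_ *m _); apply/rowP => i; rewrite mxE [RHS]mxE.
  have [wi|wi] := eqVneq ((w *m C) 0 i) 0.
    by rewrite wi mulr0 oppr0.
  have -> : J i by apply/existsP; exists i; rewrite wi connect0.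
  by rewrite expr1 mulN1r.
move=> k kK.
have [/existsP[i yi]|] := boolP [exists i, (X k *m C) 0 i != 0]; last first.
  rewrite negb_exists => /forallP z0; exists false; rewrite Ds -{2}[X k]zE scale1r.
  congr (_ *m _); apply/rowP => i; move/negPn/eqP: (z0 i) => z0i.
  by rewrite mxE z0i mulr0.
exists (J i); rewrite Ds -{2}[X k]zE scalemxAl; congr (_ *m _); apply/rowP => j.
rewrite mxE [RHS]mxE; have [->|yj] := eqVneq ((X k *m C) 0 j) 0; first by rewrite !mulr0.
congr (_ ^+ nat_of_bool _ * _); apply: eq_existsb => l; congr (_ && _).
apply: same_connect => //; apply: connect1; apply/existsP; exists k.
by rewrite kK yj yi.
Qed.
End Separation.

Lemma det_rows_mx_signs X X' g (A : 'M[F]_r) :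
  (forall i, exists b : bool, X' (g i) = (-1) ^+ b *: (X (g i) *m A)) ->
  \det (rows_mx X' g) ^+ 2 = \det (rows_mx X g) ^+ 2 * \det A ^+ 2.
Proof.
move=> gA; have bX i : exists b : bool, X' (g i) == (-1) ^+ b *: (X (g i) *m A).
  by have [b ->] := gA i; exists b.
pose b i := xchoose (bX i).
have -> : rows_mx X' g = diag_mx (\row_i (-1) ^+ b i) *m (rows_mx X g *m A).
  apply/row_matrixP => i; rewrite row_rows_mx (eqP (xchooseP (bX i))) row_mul.
  by rewrite row_diag_mx mxE -scalemxAl -rowE -rows_mxM row_rows_mx.
rewrite !det_mulmx det_diag !exprMn -prodrXl big1 ?mul1r // => i _.
by rewrite mxE sqrr_sign.
Qed.

Lemma rows_eq_up_to_sign X X' g :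
  (forall f, \det (rows_mx X f) ^+ 2 = \det (rows_mx X' f) ^+ 2) ->
  \det (rows_mx X g) != 0 ->
  exists2 A : 'M[F]_r, \det A ^+ 2 = 1 &
    forall e, exists b : bool, X' e = (-1) ^+ b *: (X e *m A).
Proof.
move=> XX' g0.
have gu : rows_mx X g \in unitmx by rewrite unitmxE unitfE.
have det2 A : (forall i, exists b : bool, X' (g i) = (-1) ^+ b *: (X (g i) *m A)) ->
    \det A ^+ 2 = 1.
  move=> /det_rows_mx_signs/esym/eqP; rewrite -XX' -{2}[_ ^+ 2]mulr1 => /eqP/mulfI; apply.
  by rewrite sqrf_eq0.
suff [A gA HA] : exists2 A : 'M[F]_r,
    forall i, exists b : bool, X' (g i) = (-1) ^+ b *: (X (g i) *m A) &
    {in enum E, forall e, exists b : bool, X' e = (-1) ^+ b *: (X e *m A)}.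
  by exists A => [|e]; [exact: det2|apply: HA; rewrite mem_enum].
(* Induction on the vectors already matched. The initial [A] carries the basis [X \o g] to
   [X' \o g]; each new vector [e] composes [A] with an involution. *)
elim: (enum E) => [|e s [A gA HA]].
  exists (invmx (rows_mx X g) *m rows_mx X' g) => // i.
  exists false; rewrite expr0 scale1r -!row_rows_mx -row_mul mulmxA.
  by rewrite mulmxV // mul1mx.
pose Y e := X e *m A.
pose K := [pred k | (k \in s) || (k \in codom g)].
have YK k : k \in K -> exists b : bool, X' k = (-1) ^+ b *: Y k.
  by case/orP => [/HA //|/codomP[i ->]]; exact: gA.
have bK k : exists b : bool, (k \in K) ==> (X' k == (-1) ^+ b *: Y k).
  (* Outside [K] the sign is an arbitrary default. *)
  case kK: (k \in K); last by exists true.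
  by have [b ->] := YK k kK; exists b; rewrite eqxx.
have {YK bK} [b bP] : exists b : E -> bool, forall k, k \in K -> X' k = (-1) ^+ (b k) *: Y k.
  exists (fun k => xchoose (bK k)) => k kK.
  by have /implyP/(_ kK)/eqP := xchooseP (bK k).
have detA := det2 A gA.
(* By Cramer's rule and the equality of squared determinants, [Y e] and [X' e] have equal or
   opposite coordinates at each [i]; [dg] absorbs the signs relating the bases [Y \o h] and
   [X' \o h]. *)
have uw h C : dual_basis Y K h C -> forall i,
    ((Y e - X' e) *m C) 0 i = 0 \/ ((Y e + X' e) *m C) 0 i = 0.
  move=> [hK CB] i.
  pose dg := diag_mx (\row_i (-1) ^+ (b (h i))) : 'M[F]_r.
  have dg2 : dg *m dg = 1%:M.
    rewrite mulmx_diag; apply/matrixP => k l; rewrite !mxE -expr2.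
    by rewrite sqrr_sign.
  have E1 : rows_mx X' h = dg *m rows_mx Y h.
    apply/row_matrixP => k; rewrite row_rows_mx bP // row_mul row_diag_mx mxE.
    by rewrite -scalemxAl -rowE row_rows_mx.
  have CB' : (C *m dg) *m rows_mx X' h = 1%:M.
    by rewrite E1 mulmxA -[C *m _ *m _]mulmxA dg2 mulmx1.
  have := XX' (replace h i e).
  have Ydet f : \det (rows_mx X f) ^+ 2 = \det (rows_mx Y f) ^+ 2.
    by rewrite rows_mxM det_mulmx exprMn detA mulr1.
  rewrite Ydet (coord_replace _ _ CB) (coord_replace _ _ CB').
  rewrite !exprMn -(XX' h) Ydet.
  have [_ Bu] := mulmx1_unit CB; rewrite unitmxE unitfE in Bu.
  move=> /mulIf; rewrite sqrf_eq0 => /(_ Bu).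
  rewrite mulmxA mul_mx_diag [X in _ = X ^+ 2]mxE [X in _ = (_ * X) ^+ 2]mxE.
  rewrite exprMn sqrr_sign mulr1 => /eqP.
  rewrite eqf_sqr => /orP[] /eqP E2; [left|right].
    rewrite mulmxBl mxE [X in _ + X]mxE E2; exact: subrr.
  rewrite mulmxDl mxE E2; exact: addNr.
have gC : dual_basis Y K g (invmx (rows_mx Y g)).
  split; first by move=> i; rewrite inE codom_f orbT.
  have Au : A \in unitmx by rewrite unitmxE unitfE -sqrf_eq0 detA oner_eq0.
  by rewrite mulVmx // rows_mxM unitmx_mul gu Au.
have [S [SS Su Sw] SK] := separating_involution uw gC.
have SK' k : k \in K -> exists b : bool, X' k = (-1) ^+ b *: (X k *m (A *m S)).
  move=> kK; have [c cE] := SK k kK; exists (b k (+) c).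
  by rewrite mulmxA cE scalerA signr_addb -mulrA -expr2 sqrr_sign mulr1 bP.
exists (A *m S) => [i|k]; first by apply: SK'; rewrite inE codom_f orbT.
rewrite inE => /orP[/eqP ->|ks]; last by apply: SK'; rewrite inE ks.
(* [Y e] is half the sum of the fixed vector [Y e - X' e] and the negated vector [Y e + X' e], so
   [S] sends it to [- X' e]. *)
exists true; rewrite expr1 scaleN1r mulmxA.
have two : (2%:R : F) != 0 by rewrite pnatr_eq0.
have -> : X e *m A = 2%:R^-1 *: ((Y e - X' e) + (Y e + X' e)).
  apply: (scalerI two); rewrite scalerA divff // scale1r scaler_nat mulr2n.
  by rewrite addrACA addNr addr0.
rewrite -scalemxAl mulmxDl Su Sw -scalerN; apply: (scalerI two).
rewrite scalerA divff // scale1r scaler_nat mulr2n.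
by rewrite !opprD !opprK addrACA addNr add0r.
Qed.
End Signs.

(** * Continuity of row vectors, integer powers and products *)

Section Continuity.
(* Stated for an abstract field: unfolding [C R] makes unification diverge. *)
Variables (K : numClosedFieldType) (T : topologicalType) (x : T).

Lemma row_continuous n (F : T -> 'rV[K]_n) :
  (forall j, {for x, continuous (fun y => F y 0 j)}) -> {for x, continuous F}.
Proof.
move=> Fj A [P PF PA]; apply: (filterS (P := fun y => forall j, P 0 j (F y 0 j))).
  by move=> y Py; apply: PA => i j; rewrite (ord1 i).
by apply: filter_forall => j; apply: (Fj j); exact: PF.
Qed.

Lemma exprz_continuous (f : T -> K) (k : int) :
  f x != 0 -> {for x, continuous f} -> {for x, continuous (fun y => f y ^ k)}.
Proof.
move=> fx0 fc.
have nat_case n : {for x, continuous (fun y => f y ^+ n)}.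
  elim: n => [|n IH].
    have -> : (fun y => f y ^+ 0) = cst 1 by apply/funext => y; rewrite expr0.
    exact: cst_continuous.
  have -> : (fun y => f y ^+ n.+1) = f \* (fun y => f y ^+ n).
    by apply/funext => y; rewrite exprS.
  exact: continuousM.
case: k => n; first exact: nat_case.
apply: continuousV; last exact: nat_case.
exact: expf_neq0.
Qed.

Lemma prod_continuous (I : finType) (f : I -> T -> K) :
  (forall i, {for x, continuous (f i)}) ->
  {for x, continuous (fun y => \prod_i f i y)}.
Proof. by move=> fc; apply: cvg_big => [|i _]; [exact: mul_continuous|exact: fc]. Qed.

End Continuity.

(** * Characters and monomial maps of tori *)

Section Monomial.
Variable R : realType.

(** A homomorphism of tori followed by the translation by [c]; the homomorphism pulls the character
    [m] back to [m *m M]. *)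
Definition monomial_map n r (c : 'rV[C R]_n) (M : 'M[int]_(n, r)) (t : 'rV[C R]_r) :
    'rV[C R]_n :=
  \row_j (c 0 j * character (row j M) t).

Lemma character_neq0 r (m : 'rV[int]_r) (t : 'rV[C R]_r) :
  torus t -> character m t != 0.
Proof. by move=> tT; apply/prodf_neq0 => i _; rewrite expfz_neq0. Qed.

Lemma characterD r (m n : 'rV[int]_r) (t : 'rV[C R]_r) :
  torus t -> character (m + n) t = character m t * character n t.
Proof.
move=> tT; rewrite /character -big_split; apply: eq_bigr => i _.
by rewrite mxE expfzDr.
Qed.

Lemma character0 r (t : 'rV[C R]_r) : character 0 t = 1.
Proof. by rewrite /character big1 // => i _; rewrite mxE expr0z. Qed.

Lemma characterN r (m : 'rV[int]_r) (t : 'rV[C R]_r) :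
  character (- m) t = (character m t)^-1.
Proof.
by rewrite /character -prodfV; apply: eq_bigr => i _; rewrite mxE invr_expz.
Qed.

(** This is why matching characters up to sign is enough to match centred hypertori. *)
Lemma character_sign r (b : bool) (m : 'rV[int]_r) (t : 'rV[C R]_r) :
  (character ((-1) ^+ b *: m) t == 1) = (character m t == 1).
Proof.
case: b; first by rewrite expr1 scaleN1r characterN -(inj_eq invr_inj) invrK invr1.
by rewrite expr0 scale1r.
Qed.

Lemma characterZ r (m : 'rV[int]_r) (k : int) (t : 'rV[C R]_r) :
  torus t -> character (k *: m) t = character m t ^ k.
Proof.
move=> tT; rewrite /character (big_morph (fun z : C R => z ^ k) (id1 := 1) (op1 := *%R)) => [|x y|].
- by apply: eq_bigr => i _; rewrite mxE mulrC exprz_exp.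
- exact: expfzMl.
exact: exp1rz.
Qed.

Lemma monomial_map_torus n r (c : 'rV[C R]_n) (M : 'M[int]_(n, r)) t :
  torus c -> torus t -> torus (monomial_map c M t).
Proof. by move=> cT tT j; rewrite mxE mulf_neq0 // character_neq0. Qed.

Lemma character_monomial_map n r (m : 'rV[int]_n) (c : 'rV[C R]_n)
    (M : 'M[int]_(n, r)) t : torus t ->
  character m (monomial_map c M t) = character m c * character (m *m M) t.
Proof.
move=> tT; rewrite /character -[\prod_(i < r) _]/(character (m *m M) t).
rewrite mulmx_sum_row (big_morph (fun x => character x t) (id1 := 1) (op1 := *%R)).
- rewrite -big_split; apply: eq_bigr => i _.
  by rewrite mxE expfzMl characterZ.
- by move=> x y; rewrite characterD.
exact: character0.
Qed.

Lemma monomial_map_comp n p r (c : 'rV[C R]_n) (M : 'M[int]_(n, p))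
    (d : 'rV[C R]_p) (N : 'M[int]_(p, r)) t : torus t ->
  monomial_map c M (monomial_map d N t) =
  monomial_map (monomial_map c M d) (M *m N) t.
Proof.
move=> tT; apply/rowP => j.
rewrite mxE [RHS]mxE character_monomial_map // row_mul mulrA.
by congr (_ * _); rewrite mxE.
Qed.

Definition torus1 r : 'rV[C R]_r := const_mx 1.

Lemma torus1P r : torus (torus1 r).
Proof. by move=> i; rewrite mxE oner_neq0. Qed.

Lemma character1 r (m : 'rV[int]_r) : character m (torus1 r) = 1.
Proof. by rewrite /character big1 // => i _; rewrite mxE exp1rz. Qed.

Lemma character_delta r (t : 'rV[C R]_r) j : character (row j 1%:M) t = t 0 j.
Proof.
rewrite /character (bigD1 j) //= big1 ?mulr1 => [|i ij].
  by rewrite !mxE eqxx expr1z.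
by rewrite !mxE eq_sym (negbTE ij) expr0z.
Qed.

Lemma monomial_map_inverse r (c : 'rV[C R]_r) (M N : 'M[int]_r) :
  M *m N = 1%:M -> torus c -> exists c', [/\ torus c',
    forall t, torus t -> monomial_map c' M (monomial_map c N t) = t &
    forall t, torus t -> monomial_map c N (monomial_map c' M t) = t].
Proof.
move=> MN cT; have NM := mulmx1C MN.
have m1 (b t : 'rV[C R]_r) : b = torus1 r -> monomial_map b 1%:M t = t.
  by move=> ->; apply/rowP => j; rewrite mxE character_delta mxE mul1r.
(* The entries are the inverses of the characters [row j M] at [c], so that the translations cancel
   in the composites. *)
pose c' := monomial_map (torus1 r) (- M) c.
exists c'; split=> [|t tT|t tT].
- exact: monomial_map_torus (@torus1P r) cT.
- rewrite monomial_map_comp // MN; apply: m1; apply/rowP => j.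
  rewrite mxE [RHS]mxE mxE [torus1 r 0 j]mxE mul1r.
  rewrite (_ : row j (- M) = - row j M); last by apply/rowP => i; rewrite !mxE.
  by rewrite characterN mulVf ?character_neq0.
rewrite monomial_map_comp // NM; apply: m1; apply/rowP => j.
rewrite mxE [RHS]mxE character_monomial_map // character1 mul1r mulmxN -row_mul NM.
by rewrite characterN character_delta mulfV.
Qed.

Lemma monomial_map_continuous n r (c : 'rV[C R]_n) (M : 'M[int]_(n, r)) t :
  torus t -> {for t, continuous (monomial_map c M)}.
Proof.
move=> tT; apply: row_continuous => j.
rewrite (_ : (fun y => _) = (cst (c 0 j) \* (fun y => character (row j M) y))).
  apply: continuousM; first exact: cst_continuous.
  apply: prod_continuous => i; apply: exprz_continuous => //; exact: coord_continuous.
by apply/funext => y; rewrite mxE.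
Qed.

Lemma real_complex_continuous : continuous (fun x : R => x%:C%C : C R).
Proof.
move=> x; apply/cvgrPdist_lt => e e0.
have eE : e = (complex.Re e)%:C%C by rewrite RRe_real // gtr0_real.
have e0' : 0 < complex.Re e by move: e0; rewrite {1}eE ltcR.
near=> y; rewrite eE -rmorphB normc_def /= expr0n addr0 sqrtr_sqr ltcR.
near: y; exact: (@cvgr_dist_lt _ _ _ _ _ id x).
Unshelve. all: end_near. Qed.

(** Finite sets are closed in a Hausdorff space, so both [[set x]] and its complement in [A] are
    closed, and [[set x]] is open and closed in [A]. *)
Lemma connected_finite_set1 n (A : set 'rV[C R]_n) x :
  finite_set A -> connected A -> A x -> A = [set x].
Proof.
move=> fA cA Ax.
have fc : forall B : set 'rV[C R]_n, finite_set B -> closed B.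
  apply/accessible_finite_set_closed; apply: hausdorff_accessible.
  exact: norm_hausdorff.
apply/esym; apply: cA; first by exists x.
  exists (~` (A `\ x)); first by apply: closed_openC; apply: fc; exact: finite_setD.
  apply/seteqP; split => [y ->|y [Ay nAy]]; first by split => // -[_]; exact.
  by apply: contrapT => yx; apply: nAy.
exists [set x]; first by apply: fc; exact: finite_set1.
by apply/seteqP; split => [y ->|y []].
Qed.
End Monomial.

(** * Roots of unity and integer matrices *)

(** As the exponent is nonzero in [L], the polynomial ['X^n - 1] is separable and splits into
    distinct linear factors; inverting the power reduces a negative exponent to a positive one. *)
Lemma unity_roots_seq (L : closedFieldType) (k : int) :
  (`|k|%N)%:R != 0 :> L ->
  {rs : seq L | [/\ uniq rs, size rs = `|k|%N & forall z, (z \in rs) = (z ^ k == 1)]}.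
Proof.
set n := `|k|%N => n0.
have n_gt0 : (0 < n)%N by case: n n0 => //; rewrite eqxx.
have [rs Drs] := closed_field_poly_normal ('X^n - 1 : {poly L}).
have mon : lead_coef ('X^n - 1 : {poly L}) = 1 by apply/eqP; exact: monicXnsubC.
rewrite mon scale1r in Drs.
exists rs; split.
- by rewrite -separable_prod_XsubC -Drs separable_Xn_sub_1.
- have : size ('X^n - 1 : {poly L}) = n.+1 by rewrite size_XnsubC.
  by rewrite Drs size_prod_XsubC => -[].
move=> z; rewrite -root_prod_XsubC -Drs rootE !hornerE subr_eq0.
rewrite /n; case: k {n0 n_gt0 mon Drs} @n => m //=.
by rewrite NegzE -exprnN invr_eq1.
Qed.

Lemma diag_mx_normal_form r (M : 'M[int]_r) :
  exists L, exists2 N, L \in unitmx /\ N \in unitmx &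
  exists d : 'rV[int]_r, M = L *m diag_mx d *m N.
Proof.
have [L Lu [N Nu [d _ ->]]] := int_Smith_normal_form M.
exists L, N => //; exists (\row_i d`_i); congr (_ *m _ *m _).
by apply/matrixP => i j; rewrite !mxE -val_eqE.
Qed.

Lemma absz_det_unitmx r (L : 'M[int]_r) : L \in unitmx -> `|\det L|%N = 1%N.
Proof. by rewrite unitmxE => /orP[] /eqP ->. Qed.

Lemma singular_int_kernel r (M : 'M[int]_r) : \det M = 0 ->
  exists2 v : 'cV[int]_r, v != 0 & M *m v = 0.
Proof.
move/eqP; rewrite -det_tr => /det0P[v v0 vM]; exists v^T.
  by rewrite -(inj_eq (@trmx_inj _ _ _)) trmxK trmx0.
by rewrite -[M]trmxK -trmx_mul vM trmx0.
Qed.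

(** * Intersections of [r] hypertori and their determinants *)

Section Flats.
Variables (R : realType) (r : nat) (E : finType) (D : toric_arrangement R r E).

(** Translating by a point of the hypertorus absorbs its coefficient and leaves the kernel of the
    pulled-back character. *)
Lemma hypertorus_monomial_map n e t0 (N : 'M[int]_(r, n)) s :
  hypertorus D e t0 -> torus s ->
  hypertorus D e (monomial_map t0 N s) <-> character (chr D e *m N) s = 1.
Proof.
move=> [t0T et0] sT; rewrite /hypertorus /= character_monomial_map // mulrA et0 mul1r.
by split => [[]//|]; split => //; exact: monomial_map_torus.
Qed.

Variable f : 'I_r -> E.
Let M := rows_mx (chr D) f.

Lemma flat_rangeP t :
  flat D (range f) t <-> torus t /\ forall i, hypertorus D (f i) t.
Proof.
split=> [[tT H]|[tT H]]; split => //; first by move=> i; apply: H; exists i.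
by move=> _ [i _ <-].
Qed.

Variable t0 : 'rV[C R]_r.
Hypothesis t0f : flat D (range f) t0.

Lemma flat_monomial_map n (N : 'M[int]_(r, n)) s : torus s ->
  flat D (range f) (monomial_map t0 N s) <->
  forall i, character (row i (M *m N)) s = 1.
Proof.
move=> sT; have /flat_rangeP[t0T H] := t0f.
have E1 i : character (row i (M *m N)) s = character (chr D (f i) *m N) s.
  rewrite row_mul; congr (character (_ *m _) _).
  by apply/rowP => j; rewrite !mxE.
split => [/flat_rangeP[_ H1] i|H1].
  by rewrite E1; apply/(hypertorus_monomial_map _ (H i)).
apply/flat_rangeP; split; first exact: monomial_map_torus.
by move=> i; apply/(hypertorus_monomial_map _ (H i)) => //; rewrite -E1.
Qed.

(* An integer vector v in the kernel of M spans the curve x |-> t0 x^v in the flat. *)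
Lemma flat_component_singular : \det M = 0 ->
  connected_component (flat D (range f)) t0 <> [set t0].
Proof.
move=> /singular_int_kernel[v v0 Mv] comp1.
have t0T : torus t0 by case: t0f.
pose c (x : R) : 'rV[C R]_1 := const_mx (x%:C%C : C R).
have cT x : 0 < x -> torus (c x).
  by move=> x0 i; rewrite mxE; apply/eqP => -[x0']; rewrite x0' ltxx in x0.
pose g x := monomial_map t0 v (c x).
have g1 : g 1 = t0.
  have c1 : c 1 = torus1 R 1 by apply/rowP => i; rewrite !mxE.
  by apply/rowP => j; rewrite mxE c1 character1 mulr1.
have g_flat x : 0 < x -> flat D (range f) (g x).
  move=> x0; apply/flat_monomial_map; first exact: cT.
  move=> i; rewrite Mv; rewrite (_ : row i 0 = 0) ?character0 //.
  by apply/rowP => j; rewrite !mxE.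
(* The curve is at [t0] for parameter 1. At parameter 2 it is elsewhere, because [2 ^ v j 0 = 1]
   forces [v j 0 = 0]. *)
have gc : {within `[1, 2], continuous g}.
  apply: continuous_in_subspaceT => x; rewrite inE /= in_itv /= => /andP[x1 _].
  apply: (@continuous_comp _ _ _ c (monomial_map t0 v)).
    apply: row_continuous => j.
    rewrite (_ : (fun y => _) = (fun y : R => y%:C%C : C R)).
      exact: real_complex_continuous.
    by apply/funext => y; rewrite mxE.
  by apply: monomial_map_continuous; apply: cT; exact: lt_le_trans x1.
have : connected_component (flat D (range f)) t0 (g 2).
  have gI := connected_continuous_connected (@segment_connected R 1 2) gc.
  apply: (connected_component_max _ _ gI).
  - by exists 1; rewrite //= in_itv /= lexx ler1n.
  - by move=> y [x]; rewrite /= in_itv /= => /andP[x1 _] <-; apply: g_flat; exact: lt_le_trans x1.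
  by exists 2; rewrite //= in_itv /= lexx ler1n.
rewrite comp1 /= => g2.
have [j vj] : exists j, v j 0 != 0.
  by apply/existsP; apply: contraNT v0; rewrite negb_exists => /forallP H;
    apply/eqP/colP => j; rewrite mxE; apply/eqP; move: (H j); rewrite negbK.
move/rowP/(_ j): g2; rewrite mxE -[RHS]mulr1 => /mulfI => /(_ (t0T j)).
rewrite /character big_ord1 !mxE => /eqP.
rewrite (_ : (2 : R)%:C%C = 2 :> C R); last by rewrite rmorph_nat.
by rewrite pexprz_eq1 ?ler0n // (negbTE vj) -subr_eq0 /= -(natrB _ (isT : (1 <= 2)%N)) oner_eq0.
Qed.

(** Write [M = L *m diag_mx d *m N] with [L] and [N] unimodular. In the coordinates [s] given by [N]
    and centred at [t0], the flat consists of the solutions of [s 0 i ^ d 0 i = 1], and the product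
    of the [|d 0 i|] is [|\det M|]. *)
Lemma flat_card : \det M != 0 -> (flat D (range f) #= `I_`|\det M|%N)%card.
Proof.
move=> M0; have t0T : torus t0 by case: t0f.
have [L [N [Lu Nu] [d ME]]] := diag_mx_normal_form M.
have detM : `|\det M|%N = (\prod_i `|d 0%R i|)%N.
  rewrite ME !det_mulmx det_diag !abszM !absz_det_unitmx // mul1n muln1.
  by rewrite (big_morph _ abszM (erefl : `|1%:Z|%N = 1%N)).
have d0 i : (`|d 0%R i|%N)%:R != 0 :> C R.
  rewrite pnatr_eq0 absz_eq0; apply: contraNneq M0 => di.
  by rewrite -absz_eq0 detM (bigD1 i) //= di.
pose rs i := sval (unity_roots_seq (d0 i)).
have rsU i : uniq (rs i) by rewrite /rs; case: unity_roots_seq => ? [].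
have rsS i : size (rs i) = `|d 0%R i|%N by rewrite /rs; case: unity_roots_seq => ? [].
have rsE i z : (z \in rs i) = (z ^ d 0 i == 1) by rewrite /rs; case: unity_roots_seq => ? [].
have di0 i : d 0 i != 0 by rewrite -absz_eq0 -(pnatr_eq0 (C R)).
pose J := {dffun forall i : 'I_r, 'I_(`|d 0%R i|%N)}.
pose h (j : J) : 'rV[C R]_r := \row_i nth 1 (rs i) (j i).
have h_rs (j : J) i : h j 0 i \in rs i by rewrite mxE mem_nth // rsS.
have hT j : torus (h j).
  move=> i; have := h_rs j i; rewrite rsE; apply: contraTneq => ->.
  by rewrite exp0rz (negbTE (di0 i)) eq_sym oner_eq0.
have h_inj : injective h.
  move=> j k jk; apply/ffunP => i; apply/val_inj/eqP.
  rewrite -(nth_uniq 1 _ _ (rsU i)) ?rsS ?ltn_ord //; apply/eqP.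
  by move/rowP/(_ i): jk; rewrite !mxE.
have h_surj (s : 'rV[C R]_r) : (forall i, s 0 i \in rs i) -> exists j, s = h j.
  move=> H; have Hi i : (index (s 0%R i) (rs i) < `|d 0%R i|)%N by rewrite -rsS index_mem.
  exists [ffun i => Ordinal (Hi i)]; apply/rowP => i.
  by rewrite mxE ffunE /= nth_index.
have diag_char i (s : 'rV[C R]_r) : character (row i (diag_mx d)) s = s 0 i ^ d 0 i.
  rewrite /character (bigD1 i) //= big1 ?mulr1; last first.
    by move=> j ji; rewrite !mxE eq_sym (negbTE ji) mulr0n expr0z.
  by rewrite !mxE eqxx mulr1n.
have MN : M *m invmx N = L *m diag_mx d by rewrite ME mulmxK.
have flat_h s : torus s -> flat D (range f) (monomial_map t0 (invmx N) s) <->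
    forall i, s 0 i \in rs i.
  move=> sT; rewrite flat_monomial_map // MN.
  have T1 := @torus1P R r.
  have mm (K : 'M[int]_r) : (forall i, character (row i K) s = 1) <->
      monomial_map (torus1 R r) K s = torus1 R r.
    split=> [H|/rowP H i]; first by apply/rowP => i; rewrite !mxE H mulr1.
    by have := H i; rewrite !mxE mul1r.
  have mulK (A K : 'M[int]_r) : monomial_map (torus1 R r) K s = torus1 R r ->
      monomial_map (torus1 R r) (A *m K) s = torus1 R r.
    move=> H; apply/mm => i; rewrite row_mul.
    have := character_monomial_map (row i A) (torus1 R r) K sT.
    by rewrite H character1 mul1r => <-.
  (* The unimodular factor [L] does not change the common kernel of the rows. *)
  transitivity (forall i, character (row i (diag_mx d)) s = 1).
    rewrite !mm; split; last exact: mulK.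
    by move=> /(mulK (invmx L)); rewrite mulKmx.
  by split=> H i; have := H i; rewrite rsE diag_char => /eqP.
have [c [cT can can']] := monomial_map_inverse (mulmxV Nu) t0T.
pose F (k : 'I_#|J|) := monomial_map t0 (invmx N) (h (enum_val k)).
have F_inj : injective F.
  move=> k l kl; apply/enum_val_inj/h_inj.
  by rewrite -(can _ (hT (enum_val k))) -/(F k) kl /F can.
have -> : flat D (range f) = F @` setT.
  apply/seteqP; split => [t tf|_ [k _ <-]]; last first.
    by apply/flat_h => // i; exact: h_rs.
  have tT : torus t by case: tf.
  have [s sT tE] : exists2 s, torus s & t = monomial_map t0 (invmx N) s.
    exists (monomial_map c N t); first exact: monomial_map_torus.
    by rewrite can'.
  move: tf; rewrite tE => /flat_h => /(_ sT)/h_surj[j sj].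
  exists (enum_rank j); first exact: I.
  by rewrite sj; congr monomial_map; rewrite enum_rankK.
rewrite detM.
have <- : #|J| = (\prod_i `|d 0%R i|)%N.
  rewrite card_dep_ffun foldrE big_map big_enum /=.
  by apply: eq_bigr => i _; rewrite card_ord.
apply: card_eq_trans (_ : ([set: 'I_#|J|] #= _)%card); last by rewrite card_eq_sym; exact: card_II.
by apply: inj_card_eq => k l _ _; exact: F_inj.
Qed.

(** A nonzero determinant makes the flat finite, so its connected components are points; a zero
    determinant puts a curve through [t0]. *)
Lemma flat_component1P :
  connected_component (flat D (range f)) t0 = [set t0] <-> \det M != 0.
Proof.
split=> [comp1|M0]; first by apply/eqP => M0; exact: flat_component_singular comp1.
apply: connected_finite_set1.
- apply: (sub_finite_set (@connected_component_sub _ _ _)).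
  by apply/finite_setP; exists `|\det M|%N; exact: flat_card.
- exact: component_connected.
exact: connected_component_refl.
Qed.
End Flats.

(** * Connected components and layers *)

Section Layers.
Variables (R : realType) (r : nat).
Implicit Types A L : set 'rV[C R]_r.

Lemma components_sup A L : connected L -> L !=set0 -> L `<=` A ->
  exists2 K, components A K & L `<=` K.
Proof.
move=> cL [x Lx] LA; exists (connected_component A x).
  by exists x => //; exact: LA.
exact: connected_component_max.
Qed.

Lemma components_sub A L : components A L -> L `<=` A.
Proof. by move=> [x _ ->]; exact: connected_component_sub. Qed.

Lemma components_nonempty A L : components A L -> L !=set0.
Proof. by move=> [x Ax ->]; exists x; exact: connected_component_refl. Qed.

Lemma components_connected A L : components A L -> connected L.
Proof. by move=> [x _ ->]; exact: component_connected. Qed.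

Lemma components_cover A : \bigcup_(L in components A) L = A.
Proof.
apply/seteqP; split => [x [L /components_sub LA /LA]//|x Ax].
by exists (connected_component A x); [exists x|exact: connected_component_refl].
Qed.

Lemma components_maximal A L K : components A L -> connected K -> K `<=` A ->
  L `<=` K -> K = L.
Proof.
move=> cAL cK KA LK; apply/seteqP; split => //.
have [x Ax LE] := cAL; rewrite LE; apply: connected_component_max => //.
by apply: LK; rewrite LE; exact: connected_component_refl.
Qed.

Lemma components_set1 A x : components A [set x] <->
  A x /\ connected_component A x = [set x].
Proof.
split=> [[y Ay xE]|[Ax xE]]; last by exists x.
have xy : y = x by rewrite -[y = x]/([set x] y) xE; exact: connected_component_refl.
by split; [rewrite -xy|rewrite -{1}xy -xE].
Qed.

Variables (E : finType) (D : toric_arrangement R r E).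

(** The right side involves only inclusions, so an isomorphism of posets can transport it. It holds
    because layers are connected and every component of a flat is itself a layer. *)
Lemma layersP S L : layers D L -> components (flat D S) L <->
  L `<=` flat D S /\ forall K, layers D K -> K `<=` flat D S -> L `<=` K -> K `<=` L.
Proof.
move=> [S' LL]; split=> [cL|[LS Lmax]].
  split=> [|K [S'' KK] KS LK]; first exact: components_sub cL.
  by rewrite (components_maximal cL (components_connected KK) KS LK).
have [K cK LK] := components_sup (components_connected LL) (components_nonempty LL) LS.
suff -> : L = K by [].
apply/seteqP; split => //; apply: Lmax => //; first by exists S.
exact: components_sub cK.
Qed.

Lemma layers_connected L : layers D L -> connected L.
Proof. by move=> [S]; exact: components_connected. Qed.

Lemma layers_nonempty L : layers D L -> L !=set0.
Proof. by move=> [S]; exact: components_nonempty. Qed.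

Lemma layers_torus L : layers D L -> L `<=` @torus R r.
Proof. by move=> [S /components_sub LS] x /LS[]. Qed.

Lemma hypertorus_layers e L : components (hypertorus D e) L -> layers D L.
Proof.
move=> cL; exists [set e]; rewrite (_ : flat D [set e] = hypertorus D e) //.
rewrite /flat bigcap_set1; apply/seteqP; split => [x [] //|x xe]; split => //.
by case: xe.
Qed.

Lemma flat_subP L S : layers D L ->
  L `<=` flat D S <-> forall e, S e -> L `<=` hypertorus D e.
Proof.
move=> LL; split=> [LS e Se x /LS[_]|H x Lx]; first exact.
by split; [exact: layers_torus LL _ Lx|move=> e Se; exact: H].
Qed.

Lemma essential_basis : essential D ->
  exists g : 'I_r -> E, \det (rows_mx (chr D) g) != 0.
Proof.
rewrite /essential; set A := \matrix_(k, j) _ => rkA.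
have fullA : row_full A by apply/eqP.
have := fullrowsub_unit fullA; set h := fullrankfun fullA => Au.
exists (fun i => enum_val (h i)); rewrite -(intr_eq0 rat).
rewrite -(det_map_mx intr) -unitfE -unitmxE.
suff -> : map_mx intr (rows_mx (chr D) (fun i => enum_val (h i))) = rowsub h A by [].
by apply/matrixP => i j; rewrite !mxE.
Qed.

(** All components are points here, so this is the point count of the flat, expressed by layers. *)
Lemma components_flat_card (f : 'I_r -> E) t0 : flat D (range f) t0 ->
  \det (rows_mx (chr D) f) != 0 ->
  (components (flat D (range f)) #= `I_`|\det (rows_mx (chr D) f)|%N)%card.
Proof.
move=> t0f M0; apply: card_eq_trans (flat_card t0f M0).
have -> : components (flat D (range f)) = set1 @` flat D (range f).
  by apply/seteqP; split => [L [x xf ->]|L [x xf <-]]; exists x => //;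
    rewrite (flat_component1P xf).2.
by apply: inj_card_eq => x y _ _ /seteqP[+ _] => /(_ x erefl).
Qed.
End Layers.

(** * Transport along an isomorphism of posets of layers *)

Section SameLayers.
Variables (R : realType) (r : nat) (E E' : finType).
Variables (D : toric_arrangement R r E) (D' : toric_arrangement R r E').
Variable phi : set 'rV[C R]_r -> set 'rV[C R]_r.
Hypothesis phi_bij : set_bij (layers D) (layers D') phi.
Hypothesis phi_le : forall X Y, layers D X -> layers D Y ->
  (layer_le (phi X) (phi Y) <-> layer_le X Y).
Variable tau : E -> E'.
Hypothesis phi_tau : forall e,
  components (hypertorus D' (tau e)) = phi @` components (hypertorus D e).

Let phi_layers L : layers D L -> layers D' (phi L).
Proof. by case: phi_bij => H _ _; exact: H. Qed.

(** A layer is connected, hence lies in a hypertorus exactly when it lies below one of its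
    components, and [phi] matches these components. *)
Lemma phi_sub_hypertorus L e : layers D L ->
  phi L `<=` hypertorus D' (tau e) <-> L `<=` hypertorus D e.
Proof.
move=> LL; have pL := phi_layers LL; split=> sub.
  have [K' K'c LK'] := components_sup (layers_connected pL) (layers_nonempty pL) sub.
  move: K'c; rewrite phi_tau => -[K cK KE]; rewrite -KE in LK'.
  apply: subset_trans (components_sub cK).
  by apply/(phi_le (hypertorus_layers cK) LL).
have [K cK LK] := components_sup (layers_connected LL) (layers_nonempty LL) sub.
apply: (@subset_trans _ (phi K)).
  by apply/(phi_le (hypertorus_layers cK) LL).
by apply: components_sub; rewrite phi_tau; exists K.
Qed.

Lemma phi_sub_flat L S : layers D L ->
  phi L `<=` flat D' (tau @` S) <-> L `<=` flat D S.
Proof.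
move=> LL; have pL := phi_layers LL; rewrite !flat_subP //; split=> H.
  by move=> e Se; apply/phi_sub_hypertorus => //; apply: H; exists e.
by move=> _ [e Se <-]; apply/phi_sub_hypertorus => //; exact: H.
Qed.

Lemma phi_components L S : layers D L ->
  components (flat D' (tau @` S)) (phi L) <-> components (flat D S) L.
Proof.
move=> LL; have pL := phi_layers LL; rewrite !layersP //.
split=> -[sub max]; split; try exact/phi_sub_flat.
  move=> K KK KS LK; apply/(phi_le LL KK); apply: max; first exact: phi_layers.
    exact/phi_sub_flat.
  exact/(phi_le KK LL).
have [_ _ surj] := phi_bij.
move=> _ /surj[K KK <-] /phi_sub_flat => /(_ KK) KS /(phi_le KK LL) LK.
by apply/(phi_le LL KK); apply: max.
Qed.

Lemma phi_components_card S :
  (components (flat D S) #= components (flat D' (tau @` S)))%card.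
Proof.
have [_ inj surj] := phi_bij.
have -> : components (flat D' (tau @` S)) = phi @` components (flat D S).
  apply/seteqP; split => [L' cL'|_ [L cL <-]]; last first.
    by apply/phi_components => //; exists S.
  have [L LL LE] : (phi @` layers D) L' by apply: surj; exists (tau @` S).
  by exists L => //; apply/phi_components => //; rewrite LE.
rewrite card_eq_sym; apply: inj_card_eq => K L; rewrite !inE => cK cL.
by apply: inj; rewrite inE; exists S.
Qed.

Variables (x x' : 'rV[C R]_r).
Hypothesis x_layer : layers D [set x].
Hypothesis phi_x : phi [set x] = [set x'].
Hypothesis x_centre : forall e, hypertorus D e x.
Hypothesis x'_centre : forall e, hypertorus D' (tau e) x'.

(** Nonzero determinants are recovered up to sign as numbers of components, which [phi]
    preserves. *)
Lemma same_det (f : 'I_r -> E) :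
  \det (rows_mx (chr D) f) ^+ 2 = \det (rows_mx (chr D') (tau \o f)) ^+ 2.
Proof.
have xT : torus x by apply: (layers_torus x_layer).
have x'T : torus x'.
  by apply: (layers_torus (phi_layers x_layer)); rewrite phi_x.
have xf : flat D (range f) x by apply/flat_rangeP.
have x'f : flat D' (range (tau \o f)) x' by apply/flat_rangeP; split=> // i; exact: x'_centre.
have fE : range (tau \o f) = tau @` range f by rewrite image_comp.
(* Nonvanishing means that the central point is by itself a component of the flat, and [phi] carries
   [[set x]] to [[set x']]. *)
have det0 : \det (rows_mx (chr D) f) != 0 <->
    \det (rows_mx (chr D') (tau \o f)) != 0.
  rewrite -(flat_component1P xf) -(flat_component1P x'f).
  have H1 := components_set1 (flat D (range f)) x.
  have H2 := components_set1 (flat D' (range (tau \o f))) x'.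
  have H3 := phi_components (range f) x_layer; rewrite -fE phi_x in H3.
  by split=> H; [have /H2[] : components (flat D' (range (tau \o f))) [set x'] by apply/H3/H1
                |have /H1[] : components (flat D (range f)) [set x] by apply/H3/H2].
have [z|nz] := eqVneq (\det (rows_mx (chr D) f)) 0.
  have [->|/det0] := eqVneq (\det (rows_mx (chr D') (tau \o f))) 0; first by rewrite z.
  by rewrite z eqxx.
have nz' := det0.1 nz.
have := phi_components_card (range f); rewrite -fE => H.
have : (`I_`|\det (rows_mx (chr D) f)|%N #= `I_`|\det (rows_mx (chr D') (tau \o f))|%N)%card.
  apply: card_eq_trans (components_flat_card x'f nz'); apply: card_eq_trans H.
  by rewrite card_eq_sym; exact: components_flat_card xf nz.
move=> /card_eq_II abs_eq.
by rewrite -[LHS]real_normK ?num_real // -[RHS]real_normK ?num_real // -!abszE abs_eq.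
Qed.
End SameLayers.

(** * Unimodular equivalence of characters and the automorphism *)

(** The matrix is first found over the rationals. Each standard vector is an integer combination of
    characters of [D], so each row of the matrix is the same combination of the signed [X' e], hence
    integral; its determinant squares to 1. *)
Lemma characters_equivalent (R : realType) (r : nat) (E : finType)
    (D : toric_arrangement R r E) (X' : E -> 'rV[int]_r) (g : 'I_r -> E) :
  surjective_arr D -> \det (rows_mx (chr D) g) != 0 ->
  (forall f : 'I_r -> E,
    \det (rows_mx (chr D) f) ^+ 2 = \det (rows_mx X' f) ^+ 2) ->
  exists2 A : 'M[int]_r, A \in unitmx &
    forall e, exists b : bool, X' e = (-1) ^+ b *: (chr D e *m A).
Proof.
move=> Dsurj g0 detE.
pose Q (Y : E -> 'rV[int]_r) e : 'rV[rat]_r := map_mx intr (Y e).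
have detQ Y f : \det (rows_mx (Q Y) f) = (\det (rows_mx Y f))%:~R.
  by rewrite -det_map_mx; congr (\det _); apply/matrixP => i j; rewrite !mxE.
have [||A detA HA] := @rows_eq_up_to_sign rat r E (Q (chr D)) (Q X') g.
- by move=> f; rewrite !detQ -!rmorphXn /= detE.
- by rewrite detQ intr_eq0.
have [b bP] := choice HA.
have [c cP] := choice (fun i => Dsurj (row i 1%:M)).
pose A0 : 'M[int]_r := \matrix_(i, j) (\sum_e ((-1) ^+ b e *: X' e) *~ c i e) 0 j.
have AE : A = map_mx intr A0.
  apply/row_matrixP => i.
  rewrite -[A]mul1mx row_mul -(map_mx1 intr) -map_row cP.
  rewrite -map_row (_ : row i A0 = \sum_e ((-1) ^+ b e *: X' e) *~ c i e); last first.
    by apply/rowP => j; rewrite mxE mxE.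
  rewrite !raddf_sum mulmx_suml; apply: eq_bigr => e _.
  rewrite !raddfMz /= -scaler_int -scalemxAl -[RHS]scaler_int; congr (_ *: _).
  rewrite map_mxZ rmorph_sign [map_mx _ (X' e)]bP scalerA -expr2 sqrr_sign.
  by rewrite scale1r.
have XA e : X' e = (-1) ^+ b e *: (chr D e *m A0).
  have := bP e; rewrite /Q AE -map_mxM -(rmorph_sign (intr : int -> rat)) -map_mxZ.
  move=> /matrixP eqXA; apply/matrixP => i j; have := eqXA i j.
  by rewrite mxE [RHS]mxE => /intr_inj.
exists A0; last by move=> e; exists (b e).
have : (\det A0) ^+ 2 == 1.
  by rewrite -(eqr_int rat) rmorphXn /= -det_map_mx -AE detA.
by rewrite sqrf_eq1 unitmxE.
Qed.

Theorem corollary3p11 (R : realType) (r : nat) (E E' : finType)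
    (D : toric_arrangement R r E) (D' : toric_arrangement R r E')
    (D_centred : centred D) (D_surjective : surjective_arr D)
    (D_essential : essential D) (D'_essential : essential D')
    (same_layers : same_layer_poset D D') :
  exists g : 'rV[C R]_r -> 'rV[C R]_r,
    torus_automorphism g /\
    homeomorphic_onto (arr_complement D') (arr_complement D) g.
Proof.
have [phi [phi_bij phi_le phi_hyp]] := same_layers.
have /choice[tau phi_tau] : forall e, exists e',
    components (hypertorus D' e') = phi @` components (hypertorus D e).
  move=> e.
  have [e' _ eE] : [set components (hypertorus D' e') | e' in [set: E']]
      (phi @` components (hypertorus D e)) by rewrite -phi_hyp; exists e.
  by exists e'.
(* Different indices may define the same hypertorus, so [tau] reaches every hypertorus of [D'] but
   perhaps not every index. *)
have tau_onto e' : exists e, hypertorus D' e' = hypertorus D' (tau e).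
  have [e _ eE] : [set phi @` components (hypertorus D e) | e in [set: E]]
      (components (hypertorus D' e')) by rewrite phi_hyp; exists e'.
  by exists e; rewrite -[LHS]components_cover -eE -phi_tau components_cover.
have [g g0] := essential_basis D_essential.
have [g' g'0] := essential_basis D'_essential.
pose x := torus1 R r; have xT : torus x := @torus1P R r.
have x_centre e : hypertorus D e x by split=> //; rewrite D_centred mul1r character1.
have x_layer : layers D [set x].
  exists (range g); apply/components_set1; split; first exact/flat_rangeP.
  by apply/flat_component1P => //; exact/flat_rangeP.
have [px_fun _ _] := phi_bij; have px_layer := px_fun _ x_layer.
have px_sub e' : phi [set x] `<=` hypertorus D' e'.
  have [e ->] := tau_onto e'.
  by apply/(phi_sub_hypertorus phi_bij phi_le phi_tau _ x_layer) => _ ->.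
have [x' px'] := layers_nonempty px_layer.
have x'_centre e' : hypertorus D' e' x' by exact: px_sub.
have x'T : torus x' by exact: layers_torus px_layer _ px'.
have x'f : flat D' (range g') x' by apply/flat_rangeP; split => // i; exact: x'_centre.
(* The layer [phi [set x]] is connected and lies on all hypertori indexed by [g'], so it lies in the
   component of [x'] in their intersection, which is a point because [g'] has nonzero
   determinant. *)
have phi_x : phi [set x] = [set x'].
  apply/seteqP; split; last by move=> _ ->.
  rewrite -((flat_component1P x'f).2 g'0).
  apply: (connected_component_max px' _ (layers_connected px_layer)) => y py.
  apply/flat_rangeP; split; first exact: layers_torus px_layer _ py.
  by move=> i; exact: px_sub.
have detE := same_det phi_bij phi_le phi_tau x_layer phi_x x_centre
  (fun e => x'_centre (tau e)).
have [A Au AP] := characters_equivalent D_surjective g0 (X' := chr D' \o tau) detE.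
(* [hm] sends the identity to [x'] and goes from the side of [D] to that of [D']; [c] is the
   translation part of its inverse [gm]. *)
have [c [cT hK gK]] := monomial_map_inverse (mulmxV Au) x'T.
pose gm := monomial_map c A; pose hm := monomial_map x' (invmx A).
have gT t : torus t -> torus (gm t) by exact: monomial_map_torus.
have hT t : torus t -> torus (hm t) by exact: monomial_map_torus.
(* The base point [x'] absorbs the coefficient of [D'], [invmx A] returns the character to that of
   [D] up to sign, and the sign is harmless since [D] is centred. *)
have h_hyp e t : torus t -> hypertorus D' (tau e) (hm t) <-> hypertorus D e t.
  move=> tT; rewrite hypertorus_monomial_map //; have [b bE] := AP e.
  rewrite [chr D' (tau e)]bE -scalemxAl mulmxK //.
  rewrite /hypertorus /= D_centred mul1r.
  split=> [/eqP|[_ te]]; last by apply/eqP; rewrite character_sign te.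
  by rewrite character_sign => /eqP.
have h_compl t : torus t -> arr_complement D' (hm t) <-> arr_complement D t.
  move=> tT; split=> -[_ nt]; split=> //.
  - by move=> [e _ te]; apply: nt; exists (tau e) => //; apply/h_hyp.
  - exact: hT.
  - move=> [e' _]; have [e ->] := tau_onto e' => /h_hyp => /(_ tT) te.
    by apply: nt; exists e.
have g_compl t : torus t -> arr_complement D (gm t) <-> arr_complement D' t.
  move=> tT; have := h_compl _ (gT _ tT).
  have -> : hm (gm t) = t by exact: gK.
  by move=> H; apply: iff_sym.
have regular (b : 'rV[C R]_r) (M : 'M[int]_r) j :
  @regular_function R r (fun t => monomial_map b M t 0 j).
  by exists [:: (b 0 j, row j M)] => t _; rewrite big_seq1 mxE.
have morph (b : 'rV[C R]_r) (M : 'M[int]_r) : torus b -> torus_morphism (monomial_map b M).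
  by move=> bT; split=> [t /= tT|j]; [exact: monomial_map_torus|exact: regular].
have cont (A' : set 'rV[C R]_r) (b : 'rV[C R]_r) (M : 'M[int]_r) :
    A' `<=` @torus R r -> {within A', continuous (monomial_map b M)}.
  move=> A'T; apply: continuous_in_subspaceT => t; rewrite inE => /A'T tT.
  exact: monomial_map_continuous.
exists gm; split.
  split; first exact: morph.
  exists hm; split; first exact: morph.
    by move=> t; rewrite inE; exact: gK.
  by move=> t; rewrite inE; exact: hK.
split.
- split=> [t [tT nt]|s t|t [tT nt]].
  + by apply/g_compl.
  + move=> /set_mem[sT _] /set_mem[tT _] st.
    exact: etrans (esym (gK s sT)) (etrans (congr1 hm st) (gK t tT)).
  + exists (hm t); last exact: hK.
    exact/h_compl.
- by apply: cont => t [].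
exists hm; split; last by apply: cont => t [].
by move=> t; rewrite inE => -[tT _]; exact: gK.
Qed.
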